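(* Let $1<\alpha_1,\alpha_2<2$, let $k_x,k_y,\eta,\Delta t>0$ and let $n_1,n_2$ be positive integers. With $M=I-A+D$ and $P=I-\tau_1(A)+D$ the matrices defined in the context, the spectrum of $P^{-1}M$ is uniformly bounded below by $\frac12$ and bounded above by $\frac32$; that is, every eigenvalue $\lambda$ of $P^{-1}M$ satisfies $\frac12\le\lambda\le\frac32$, for all such values of the parameters.
   Context: $\Omega\subset\mathbb{R}^2$ is a convex region contained in the rectangle $\bar\Omega=(a,b)\times(c,d)$; $h_x=\frac{b-a}{n_1+1}$, $h_y=\frac{d-c}{n_2+1}$, $x_i=a+ih_x$, $y_j=c+jh_y$; $N=n_1n_2$; $I$ is the identity matrix of appropriate size ($I_n$ of size $n$). Coefficients: $g_0^{(\alpha)}=1$, $g_l^{(\alpha)}=\left(1-\frac{\alpha+1}{l}\right)g_{l-1}^{(\alpha)}$ for $l\ge1$; $c_\alpha=-\frac{1}{2\cos(\alpha\pi/2)}>0$; $c_x=\frac{\Delta t\,k_xc_{\alpha_1}}{h_x^{\alpha_1}}>0$, $c_y=\frac{\Delta t\,k_yc_{\alpha_2}}{h_y^{\alpha_2}}>0$. $G_n^{(\alpha)}$ is the $n\times n$ symmetric Toeplitz matrix whose $(i,j)$ entry is $2g_1^{(\alpha)}$ if $i=j$, $g_0^{(\alpha)}+g_2^{(\alpha)}$ if $|i-j|=1$, and $g_{|i-j|+1}^{(\alpha)}$ if $|i-j|\ge2$. Put $A_x=c_xG_{n_1}^{(\alpha_1)}$, $A_y=c_yG_{n_2}^{(\alpha_2)}$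 and $A=I_{n_2}\otimes A_x+A_y\otimes I_{n_1}$. $D=\mathrm{diag}(d_{1,1},\dots,d_{n_1,1},d_{1,2},\dots,d_{n_1,2},\dots,d_{1,n_2},\dots,d_{n_1,n_2})$ with $d_{i,j}=0$ if $(x_i,y_j)\in\Omega$ and $d_{i,j}=\frac{\Delta t}{\eta}$ if $(x_i,y_j)\in\bar\Omega\setminus\Omega$. For an $n\times n$ symmetric Toeplitz matrix $T_n=[t_{|i-j|}]$, $\tau(T_n)=T_n-H_n$, where $H_n$ is the Hankel matrix (constant along antidiagonals) whose successive antidiagonal values, for $i+j=2,3,\dots,2n$, are $t_2,t_3,\dots,t_{n-1},0,0,0,t_{n-1},\dots,t_3,t_2$. Put $\tau_1(A)=I_{n_2}\otimes\tau(A_x)+\tau(A_y)\otimes I_{n_1}$. The matrix $P$ is (symmetric) positive definite, hence invertible. *)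

(* Defs.v *)
From HB Require Import structures.
From mathcomp Require Import all_boot all_order all_algebra.
From mathcomp Require Import all_classical all_reals all_analysis.
From mathcomp Require Import mxtens complex zify.

Set Implicit Arguments.
Unset Strict Implicit.
Unset Printing Implicit Defensive.

Import Order.TTheory GRing.Theory Num.Theory.

Local Open Scope ring_scope.

Section Coefficients.
Variable R : realType.
Implicit Types (alpha : R) (l n : nat).

Fixpoint gcoef alpha l : R :=
  if l is l'.+1 then (1 - (alpha + 1) / l%:R) * gcoef alpha l' else 1.

Definition c_frac alpha : R := - (2 * cos (alpha * pi / 2))^-1.

Definition c_dir alpha (dt k h : R) : R := dt * k * c_frac alpha / h `^ alpha.

Definition step (a b : R) n : R := (b - a) / n.+1%:R.

End Coefficients.

Section Toeplitz.
Variable R : realType.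
Implicit Types (t : nat -> R) (n : nat).

Definition toeplitz n t : 'M[R]_n := \matrix_(i, j) t `|i - j|%N.

(* The antidiagonal i + j = s (1-based indices, 2 <= s <= 2n) carries the value
   t_s for s < n, 0 for s = n, n+1, n+2, and t_(2n+2-s) for s > n+2. *)
Definition hankel_val n t (s : nat) : R :=
  if (s < n)%N then t s
  else if (s <= n.+2)%N then 0
  else t (n.*2.+2 - s)%N.

(* Ordinals are 0-based, hence the shift by 2. *)
Definition hankel n t : 'M[R]_n := \matrix_(i, j) hankel_val n t (i + j).+2.

(* The k-th entry of the first row of T, i.e. t_k when T = [t_|i-j|];
   the default value 0 is only reached for k >= n. *)
Definition symbol n (T : 'M[R]_n) (k : nat) : R :=
  if (insub 0%N, insub k) is (Some i, Some j) then T i j else 0.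

Definition tau n (T : 'M[R]_n) : 'M[R]_n := T - hankel n (symbol T).

Definition G_val (alpha : R) (k : nat) : R :=
  match k with
  | 0 => 2 * gcoef alpha 1
  | 1 => gcoef alpha 0 + gcoef alpha 2
  | _ => gcoef alpha k.+1
  end.

Definition G_mx n (alpha : R) : 'M[R]_n := toeplitz n (G_val alpha).

Lemma symbol_toeplitz n t k : (k < n)%N -> symbol (toeplitz n t) k = t k.
Proof.
move=> kn; rewrite /symbol.
case: insubP => [i _ i0|]; last by rewrite (leq_ltn_trans _ kn).
by case: insubP => [j _ jk|/negP//]; rewrite mxE i0 jk dist0n.
Qed.

Lemma tau_toeplitz n t : tau (toeplitz n t) = toeplitz n t - hankel n t.
Proof.
rewrite /tau; congr (_ - _); apply/matrixP => i j; rewrite !mxE /hankel_val.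
case: ifPn => [sn|_]; first by rewrite symbol_toeplitz.
case: ifPn => // ns; rewrite symbol_toeplitz //.
have := ltn_ord i; rewrite -ltnNge in ns; lia.
Qed.

End Toeplitz.

Section System.
Variable R : realType.
Variables n1 n2 : nat.

(* Used both for A = kron_sum A_x A_y and
   for tau_1(A) = kron_sum (tau A_x) (tau A_y). *)
Definition kron_sum (X : 'M[R]_n1) (Y : 'M[R]_n2) : 'M[R]_(n2 * n1) :=
  1%:M *t X + Y *t 1%:M.

(* The flat index of (j, i) in 'I_(n2 * n1) is j * n1 + i, so i varies fastest.
   The 0-based ordinal i stands for the grid index i + 1, likewise for j.
   All grid points lie in the open rectangle, so the negation of membership
   in Omega is membership in the complement of Omega in the rectangle. *)
Definition penalty_mx (Omega : set (R^o * R^o)) (a b c d dt eta : R) :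
    'M[R]_(n2 * n1) :=
  diag_mx (\row_(k < n2 * n1)
    let: (j, i) := mxtens_unindex k in
    let x := a + i.+1%:R * step a b n1 in
    let y := c + j.+1%:R * step c d n2 in
    if (x, y) \in Omega then 0 else dt / eta).

End System.

(* Main.v *)
(* Write A_x = tau(A_x) + H_x with H_x the Hankel correction, and similarly in y.
   The off-diagonal coefficients t_k are nonnegative and decreasing and sum to at
   most - t_0 / 2, so - tau(A_x) + 2 H_x and - tau(A_x) - 2 H_x are symmetric and
   diagonally dominant, hence positive semidefinite. This bound passes to
   Kronecker sums, and since I and D are positive semidefinite it makes the
   quadratic form of M - P at most half that of P in absolute value. The claim
   is then the Rayleigh quotient bound for the symmetric pencil (M, P). *)
Require Import Defs.
From HB Require Import structures.
From mathcomp Require Import all_boot all_order all_algebra.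
From mathcomp Require Import all_classical all_reals all_analysis.
From mathcomp Require Import mxtens complex zify ring lra.

Set Implicit Arguments.
Unset Strict Implicit.
Unset Printing Implicit Defensive.

Import Order.TTheory GRing.Theory Num.Theory.

Local Open Scope classical_set_scope.
Local Open Scope ring_scope.
Local Open Scope complex_scope.

(** * Quadratic forms, diagonal dominance and Kronecker sums *)

Definition quad (R : pzRingType) n (A : 'M[R]_n) (u : 'rV_n) : R :=
  (u *m A *m u^T) 0 0.

Lemma sum_mxtens (V : nmodType) m n (F : 'I_(m * n) -> V) :
  \sum_k F k = \sum_j \sum_i F (mxtens_index (j, i)).
Proof.
rewrite pair_big /= (reindex (@mxtens_index m n)) /=.
  by apply: eq_bigr => -[].
exists (@mxtens_unindex m n) => ? _; [exact: mxtens_indexK|exact: mxtens_unindexK].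
Qed.

Section QuadraticForms.
Variable R : realFieldType.
Implicit Types (n : nat).

Lemma quadE n (A : 'M[R]_n) u :
  quad A u = \sum_i \sum_j u 0 i * A i j * u 0 j.
Proof.
rewrite /quad mxE exchange_big /=; apply: eq_bigr => j _.
by rewrite !mxE mulr_suml.
Qed.

Lemma quadD n (A B : 'M[R]_n) u : quad (A + B) u = quad A u + quad B u.
Proof. by rewrite /quad mulmxDr mulmxDl mxE. Qed.

Lemma quadN n (A : 'M[R]_n) u : quad (- A) u = - quad A u.
Proof. by rewrite /quad mulmxN mulNmx mxE. Qed.

Lemma quadZ n k (A : 'M[R]_n) u : quad (k *: A) u = k * quad A u.
Proof. by rewrite /quad -scalemxAr -scalemxAl mxE. Qed.

Lemma quad_diag n (d : 'rV[R]_n) u :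
  quad (diag_mx d) u = \sum_i d 0 i * u 0 i ^+ 2.
Proof.
rewrite quadE; apply: eq_bigr => i _.
rewrite (bigD1 i) //= big1 => [|j ji]; first by rewrite mxE eqxx mulr1n; ring.
by rewrite mxE eq_sym (negPf ji) mulr0n mulr0 mul0r.
Qed.

Lemma quad_diag_ge0 n (d u : 'rV[R]_n) :
  (forall i, 0 <= d 0 i) -> 0 <= quad (diag_mx d) u.
Proof.
by move=> d0; rewrite quad_diag sumr_ge0 // => i _; rewrite mulr_ge0 ?sqr_ge0.
Qed.

Lemma quad_scalar_gt0 n (u : 'rV[R]_n) : u != 0 -> 0 < quad 1%:M u.
Proof.
move=> u0; have [i ui] : exists i, u 0 i != 0 by exact/rV0Pn.
rewrite -diag_const_mx quad_diag (bigD1 i) //= mxE mul1r.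
rewrite ltr_pwDl ?exprn_even_gt0 // sumr_ge0 // => j _.
by rewrite mxE mul1r sqr_ge0.
Qed.

(** Each off-diagonal term is at least -|a_ij| (u_i^2 + u_j^2) / 2. By symmetry of [A] these bounds
    sum to minus the off-diagonal row sums weighted by u_i^2, which the diagonal absorbs. *)
Lemma dominant_quad_ge0 n (A : 'M[R]_n) u : A^T = A ->
  (forall i, \sum_(j | j != i) `|A i j| <= A i i) -> 0 <= quad A u.
Proof.
move=> symA domA; pose r i := \sum_(j | j != i) `|A i j|.
have -> : quad A u = \sum_i A i i * u 0 i ^+ 2
    + \sum_i \sum_(j | j != i) u 0 i * A i j * u 0 j.
  rewrite quadE -big_split /=; apply: eq_bigr => i _.
  by rewrite (bigD1 i) //=; congr (_ + _); ring.
have offdiag : - (\sum_i r i * u 0 i ^+ 2) <=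
    \sum_i \sum_(j | j != i) u 0 i * A i j * u 0 j.
  have -> : \sum_i r i * u 0 i ^+ 2 =
      \sum_i \sum_(j | j != i) `|A i j| * (u 0 i ^+ 2 + u 0 j ^+ 2) / 2.
    have swap : \sum_i \sum_(j | j != i) `|A i j| * u 0 j ^+ 2 =
        \sum_i \sum_(j | j != i) `|A i j| * u 0 i ^+ 2.
      rewrite (exchange_big_dep predT) //=; apply: eq_bigr => j _.
      apply: eq_big => [i|i _]; first by rewrite eq_sym.
      by rewrite -{1}symA mxE.
    transitivity (2^-1 * (\sum_i \sum_(j | j != i) `|A i j| * u 0 i ^+ 2 +
        \sum_i \sum_(j | j != i) `|A i j| * u 0 j ^+ 2)).
      rewrite swap; under eq_bigr do rewrite mulr_suml; lra.
    rewrite -big_split mulr_sumr; apply: eq_bigr => i _ /=.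
    by rewrite -big_split mulr_sumr; apply: eq_bigr => j _ /=; ring.
  rewrite -sumrN; apply: ler_sum => i _; rewrite -sumrN.
  apply: ler_sum => j _.
  have := ler_norm (- A i j); have := ler_norm (A i j); rewrite normrN.
  have := sqr_ge0 (u 0 i + u 0 j); have := sqr_ge0 (u 0 i - u 0 j).
  move: (u 0 i) (u 0 j) (A i j) `|_| => x y t s; nra.
rewrite -lerBlDl sub0r (le_trans _ offdiag) // lerN2.
by apply: ler_sum => i _; rewrite ler_wpM2r ?sqr_ge0 ?domA.
Qed.

Lemma pos_def_unitmx n (A : 'M[R]_n) :
  (forall u, u != 0 -> 0 < quad A u) -> A \in unitmx.
Proof.
move=> posA; rewrite -row_free_unit; apply: inj_row_free => v vA.
apply/eqP/negPn/negP => /posA.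
by rewrite /quad vA mul0mx mxE ltxx.
Qed.

End QuadraticForms.

(** Each identity factor forces two indices to agree, so the form splits over the lines of the
    grid. *)
Lemma quad_kron_sum (R : realType) n1 n2 (X : 'M[R]_n1) (Y : 'M[R]_n2) u :
  quad (kron_sum X Y) u =
    \sum_j quad X (\row_i u 0 (mxtens_index (j, i))) +
    \sum_i quad Y (\row_j u 0 (mxtens_index (j, i))).
Proof.
rewrite /kron_sum quadD !quadE; congr (_ + _).
  rewrite sum_mxtens; apply: eq_bigr => j _.
  rewrite quadE; apply: eq_bigr => i _.
  rewrite sum_mxtens (bigD1 j) //= [X in _ + X]big1 => [|j' j'j].
    by rewrite addr0; apply: eq_bigr => i' _; rewrite tensmxE !mxE eqxx mul1r.
  apply: big1 => i' _.
  by rewrite tensmxE !mxE eq_sym (negPf j'j) mul0r mulr0 mul0r.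
rewrite sum_mxtens exchange_big /=; apply: eq_bigr => i _.
rewrite quadE; apply: eq_bigr => j _.
rewrite sum_mxtens; apply: eq_bigr => j' _.
rewrite (bigD1 i) //= big1 => [|i' i'i].
  by rewrite addr0 tensmxE !mxE eqxx mulr1.
by rewrite tensmxE !mxE eq_sym (negPf i'i) !mulr0 mul0r.
Qed.

(** * Eigenvalues of a symmetric pencil *)

Section RayleighBounds.
Variable R : rcfType.

Lemma map_Re_mul m n p (w : 'M[R[i]]_(m, n)) (A : 'M[R]_(n, p)) :
  map_mx (@complex.Re R) (w *m map_mx (real_complex R) A) =
    map_mx (@complex.Re R) w *m A.
Proof.
apply/matrixP => i j; rewrite !mxE.
rewrite (big_morph (@complex.Re R) (id1 := 0) (op1 := +%R)) //;
  last by case=> ? ? [].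
by apply: eq_bigr => k _; rewrite !mxE; case: (w i k) => x y /=; ring.
Qed.

Lemma map_Im_mul m n p (w : 'M[R[i]]_(m, n)) (A : 'M[R]_(n, p)) :
  map_mx (@complex.Im R) (w *m map_mx (real_complex R) A) =
    map_mx (@complex.Im R) w *m A.
Proof.
apply/matrixP => i j; rewrite !mxE.
rewrite (big_morph (@complex.Im R) (id1 := 0) (op1 := +%R)) //;
  last by case=> ? ? [].
by apply: eq_bigr => k _; rewrite !mxE; case: (w i k) => x y /=; ring.
Qed.

Lemma symmetric_mulmxC n (A : 'M[R]_n) (u v : 'rV[R]_n) : A^T = A ->
  (u *m A *m v^T) 0 0 = (v *m A *m u^T) 0 0.
Proof.
move=> symA; have -> : u *m A *m v^T = (v *m A *m u^T)^T.
  by rewrite !trmx_mul trmxK symA mulmxA.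
by rewrite mxE.
Qed.

(** [eigenvalue] concerns row vectors, so for an eigenvector v the substitution w = v P^-1 gives w M
    = lambda w P. Splitting w and lambda into real and imaginary parts leaves two real equations. *)
Lemma pencil_eigenvalue_bounds n (P M : 'M[R]_n) (lo hi : R) (lambda : R[i]) :
  P^T = P -> M^T = M -> (forall u, u != 0 -> 0 < quad P u) ->
  (forall u, lo * quad P u <= quad M u <= hi * quad P u) ->
  eigenvalue (map_mx (real_complex R) (invmx P *m M)) lambda ->
  lo%:C <= lambda <= hi%:C.
Proof.
move=> symP symM posP boundsM.
have unitP := pos_def_unitmx posP.
have qP_ge0 u : 0 <= quad P u.
  have [->|/posP/ltW //] := eqVneq u 0.
  by rewrite /quad !mul0mx mxE.
case/eigenvalueP => v; rewrite map_mxM mulmxA.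
set w := v *m _ => wM v0.
have defv : v = w *m map_mx (real_complex R) P.
  by rewrite -mulmxA -map_mxM mulVmx // map_mx1 mulmx1.
move: w => w in wM defv *.
have w0 : w != 0 by apply: contraNneq v0 => w0; rewrite defv w0 mul0mx.
rewrite defv in wM.
pose a := map_mx (@complex.Re R) w; pose b := map_mx (@complex.Im R) w.
case: lambda wM => x y wM.
have eqa : a *m M = x *: (a *m P) - y *: (b *m P).
  rewrite -!map_Re_mul -map_Im_mul wM.
  by apply/matrixP => i j; rewrite !mxE; case: (\sum_ _ _).
have eqb : b *m M = x *: (b *m P) + y *: (a *m P).
  rewrite -!map_Im_mul -map_Re_mul wM.
  by apply/matrixP => i j; rewrite !mxE; case: (\sum_ _ _).
have pos_ab : 0 < quad P a + quad P b.
  have [a0|a0] := eqVneq a 0; last by rewrite ltr_wpDr ?posP.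
  rewrite ltr_wpDl ?posP //; apply: contraNneq w0 => b0; apply/eqP/matrixP => i j.
  move/matrixP/(_ i j): a0; move/matrixP/(_ i j): b0; rewrite !mxE.
  by case: (w i j) => ? ? /= -> ->.
have entryB (X Y : 'M[R]_1) : (x *: X - y *: Y) 0 0 = x * X 0 0 - y * Y 0 0.
  by rewrite !mxE.
have entryD (X Y : 'M[R]_1) : (x *: X + y *: Y) 0 0 = x * X 0 0 + y * Y 0 0.
  by rewrite !mxE.
(* Symmetry of [M] equates a M b^T with b M a^T; after expansion by [eqa] and [eqb], the terms in x
   cancel by symmetry of [P]. *)
have y0 : y = 0.
  have := symmetric_mulmxC a b symM; rewrite eqa eqb.
  rewrite mulmxBl mulmxDl -!scalemxAl entryB entryD.
  rewrite (symmetric_mulmxC a b symP) -!/(quad _ _).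
  move=> e; have : y * (quad P a + quad P b) = 0 by lra.
  by move/eqP; rewrite mulf_eq0 (gt_eqF pos_ab) orbF => /eqP.
rewrite y0 scale0r subr0 in eqa; rewrite y0 scale0r addr0 in eqb.
have := boundsM a; have := boundsM b.
have -> : quad M a = x * quad P a by rewrite /quad eqa -scalemxAl mxE.
have -> : quad M b = x * quad P b by rewrite /quad eqb -scalemxAl mxE.
move=> /andP[lb hb] /andP[la ha].
(* One of [a] and [b] may vanish, so the two bounds are added before dividing by the positive
   total. *)
by rewrite !lecE /= y0 eqxx /=; apply/andP; split;
  rewrite -(ler_pM2r pos_ab) !mulrDr lerD.
Qed.
End RayleighBounds.

(** * Signs, monotonicity and sums of the coefficients *)

Section Coefficients.
Variables (R : realType) (alpha : R).
Hypothesis alpha12 : 1 < alpha < 2.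

Lemma gcoefS k : k.+1%:R * gcoef alpha k.+1 = (k%:R - alpha) * gcoef alpha k.
Proof.
by rewrite /= mulrA -natr1; congr (_ * _); field; rewrite natr1 pnatr_eq0.
Qed.

(** Since [gcoef alpha k] is (-1)^k binomial(alpha, k), partial sums have a closed form; written
    this way, their sign is read off from the next coefficient. *)
Lemma gcoef_partial_sum m :
  alpha * \sum_(k < m.+1) gcoef alpha k = - (m.+1%:R * gcoef alpha m.+1).
Proof.
elim: m => [|m IHm]; first by rewrite big_ord1 gcoefS /=; ring.
rewrite big_ord_recr mulrDr IHm [in RHS]gcoefS -[nat_of_ord _]/m.+1.
ring.
Qed.

(** The value at 2 is alpha (alpha - 1) / 2, and from index 3 on the recurrence factor is
    nonnegative because alpha < 2. *)
Lemma gcoef_ge0 k : (1 < k)%N -> 0 <= gcoef alpha k.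
Proof.
case: k => [|[|k]] // _; elim: k => [|k IHk].
  by rewrite /= -[2%:R]/(2 : R); case/andP: alpha12 => a1 a2; nra.
rewrite -[gcoef _ _]/((1 - (alpha + 1) / k.+3%:R) * gcoef alpha k.+2).
rewrite mulr_ge0 // subr_ge0 ler_pdivrMr ?ltr0n // mul1r.
have : (3 : R) <= k.+3%:R by rewrite ler_nat.
by case/andP: alpha12 => _; lra.
Qed.

Lemma gcoef_decr k : (1 < k)%N -> gcoef alpha k.+1 <= gcoef alpha k.
Proof.
move=> k1; have g0 := gcoef_ge0 k1.
rewrite -[gcoef _ _.+1]/((1 - (alpha + 1) / k.+1%:R) * gcoef alpha k).
rewrite ler_piMl // gerBl divr_ge0 //.
by case/andP: alpha12 => a1 _; lra.
Qed.

Lemma G_val_ge0 k : (0 < k)%N -> 0 <= G_val alpha k.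
Proof.
case: k => [|[|k]] // _; last exact: gcoef_ge0.
by apply: addr_ge0; [exact: ler01|exact: gcoef_ge0].
Qed.

Lemma G_val_decr k : (0 < k)%N -> G_val alpha k.+1 <= G_val alpha k.
Proof.
case: k => [|[|k]] // _; last exact: gcoef_decr.
have := @gcoef_decr 2 isT; rewrite -[G_val _ 2]/(gcoef alpha 3).
rewrite -[G_val _ 1]/(1 + gcoef alpha 2); lra.
Qed.

(* The sum is alpha plus a partial sum of the g_k, which is nonpositive by
   gcoef_partial_sum. *)
Lemma G_val_sum n : \sum_(1 <= k < n) G_val alpha k <= - G_val alpha 0 / 2.
Proof.
have -> : - G_val alpha 0 / 2 = alpha by rewrite /=; lra.
have alpha0 : 0 < alpha by case/andP: alpha12; lra.
case: n => [|[|n]]; [by rewrite big_geq ?ltW..|].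
have -> : \sum_(1 <= k < n.+2) G_val alpha k =
    alpha + \sum_(k < n.+3) gcoef alpha k.
  rewrite big_add1 big_mkord big_ord_recl !big_ord_recl.
  under eq_bigr do rewrite -[G_val _ _]/(gcoef alpha _.+3).
  by set s := \sum_(i < n) _; rewrite /= divr1; ring.
rewrite gerDl -(pmulr_rle0 _ alpha0) gcoef_partial_sum oppr_le0.
by rewrite mulr_ge0 ?gcoef_ge0.
Qed.

Lemma c_frac_ge0 : 0 <= c_frac alpha.
Proof.
case/andP: alpha12 => a1 a2.
rewrite /c_frac -invrN invr_ge0 oppr_ge0 pmulr_rle0 //.
(* The angle lies between pi/2 and pi; shifting by pi/2 turns the cosine into minus a sine on
   [0, pi]. *)
have -> : alpha * pi / 2 = (alpha - 1) * (pi / 2) + pi / 2 :> R by ring.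
have pi0 := pi_gt0 R.
rewrite cosDpihalf oppr_le0 sin_ge0_pi //; apply/andP; split; nra.
Qed.

End Coefficients.

(** * The Hankel correction is controlled by the tau matrix *)

Section TauBound.
Variables (R : realType) (t : nat -> R) (n : nat).
Hypothesis t_ge0 : forall k, (0 < k)%N -> 0 <= t k.
Hypothesis t_decr : forall k, (0 < k)%N -> t k.+1 <= t k.
Hypothesis t_sum : \sum_(1 <= k < n) t k <= - t 0 / 2.

Let T := toeplitz n t.
Let H := hankel n t.

Lemma toeplitz_sym : T^T = T.
Proof. by apply/matrixP => i j; rewrite !mxE distnC. Qed.

Lemma hankel_sym : H^T = H.
Proof. by apply/matrixP => i j; rewrite !mxE addnC. Qed.

Lemma t_antitone k l : (0 < k <= l)%N -> t l <= t k.
Proof.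
case/andP=> k0 /subnKC <-; elim: (l - k)%N => [|m IHm]; first by rewrite addn0.
by rewrite addnS (le_trans _ IHm) // t_decr // addn_gt0 k0.
Qed.

Lemma hankel_ge0 i j : 0 <= H i j.
Proof.
rewrite mxE /hankel_val; case: ifP => [_|_]; first exact: t_ge0.
case: ifP => // _; apply: t_ge0.
by have := ltn_ord i; have := ltn_ord j; lia.
Qed.

(** A nonzero Hankel entry is [t] at i + j + 2 or at 2n - i - j, both larger than |i - j|. The
    diagonal is excluded since [t] is only known to decrease from index 1 on. *)
Lemma hankel_le_toeplitz i j : j != i -> H i j <= T i j.
Proof.
move=> ji; have {}ji : (j != i :> nat) by [].
have ij0 : (0 < `|i - j|)%N by lia.
have := ltn_ord i; have := ltn_ord j => jn i_n.
rewrite !mxE /hankel_val; case: ifP => [_|_]; first by apply: t_antitone; lia.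
by case: ifP => [_|_]; [exact: t_ge0 | apply: t_antitone; lia].
Qed.

(** The part of [T] left of the diagonal plus the part of [H] before its zero band. Reversing both
    indices produces the remaining parts. *)
Let half (i j : 'I_n) := (if (j < i)%N then t (i - j) else 0) +
  (if (i + j.+2 < n)%N then t (i + j.+2) else 0).

(** The indices i - j cover 1, ..., i and the indices i + j + 2 cover i + 2, ..., n - 1, so at most
    t_(i+1) is missing from the sum in [t_sum], and it is nonnegative. *)
Lemma half_row_sum i : \sum_j half i j <= - t 0 / 2.
Proof.
rewrite big_split /= -!big_mkcond /=.
rewrite -(big_mkord (fun j => j < i)%N (fun j => t (i - j))).
rewrite -(big_mkord (fun j => i + j.+2 < n)%N (fun j => t (i + j.+2))).
have i_n := ltn_ord i.
rewrite -[X in X + _](big_nat_widen _ _ _ predT) ?(ltnW i_n) // big_nat_rev /=.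
have -> : \sum_(0 <= j < i) t (i - (0 + i - j.+1)) = \sum_(1 <= k < i.+1) t k.
  rewrite big_add1; apply: eq_big_nat => j /andP[_ ji].
  by congr t; lia.
have -> : \sum_(0 <= j < n | (i + j.+2 < n)%N) t (i + j.+2) =
    \sum_(i.+2 <= k < n) t k.
  rewrite -[i.+2]add0n big_addn (big_nat_widen _ _ n) ?leq_subr //.
  by apply: eq_big => [j|j _]; [lia | congr t; lia].
apply: le_trans t_sum; rewrite [leRHS](big_cat_nat (n := i.+1)) //=.
rewrite lerD2l; have [ltin|leni] := ltnP i.+1 n.
  by rewrite [leRHS]big_ltn // lerDr t_ge0.
by rewrite !big_geq // ltnW.
Qed.

(* A row of T + H lists t_(i-j) and t_(i+j), whose indices are all distinct,
   together with the same entries for the reversed indices n+1-i and n+1-j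
   (1-based); each half sums to at most - t 0 / 2. *)
Lemma row_sum_le i : \sum_(j | j != i) T i j + \sum_j H i j <= - t 0.
Proof.
have -> : - t 0 = - t 0 / 2 + - t 0 / 2 by lra.
apply: le_trans (lerD (half_row_sum i) (half_row_sum (rev_ord i))).
rewrite [X in _ <= _ + X](reindex_inj rev_ord_inj) -big_split big_mkcond.
rewrite -big_split /=.
apply: ler_sum => j _; have jn := ltn_ord j; have i_n := ltn_ord i.
have -> : (if j != i then T i j else 0) =
    (if (j < i)%N then t (i - j) else 0) + (if (i < j)%N then t (j - i) else 0).
  rewrite mxE -val_eqE /=; case: (ltngtP j i) => ij; rewrite ?addr0 ?add0r //.
    by congr t; lia.
  by congr t; lia.
(* For 0-based indices, reversal turns i + j + 2 into 2n - i - j, which is below n exactly when i +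
   j + 2 lies beyond the zero band. *)
have -> : H i j = (if (i + j.+2 < n)%N then t (i + j.+2) else 0) +
    (if (rev_ord i + (rev_ord j).+2 < n)%N
     then t (rev_ord i + (rev_ord j).+2) else 0).
  rewrite mxE /hankel_val -!addnS; case: ifP => h1.
    by rewrite ifF ?addr0 //=; lia.
  rewrite add0r; case: ifP => h2; first by rewrite ifF //=; lia.
  by rewrite ifT /=; [congr t; lia | lia].
rewrite /half addrACA lerD2l lerD2r /=.
have -> : (n - j.+1 < n - i.+1)%N = (i < j)%N by lia.
by case: ifP => // ij; rewrite (_ : _ - _ = j - i)%N //; lia.
Qed.

(* For |s| <= 2 the off-diagonal entries satisfy |H - T + s H| <= T + H because
   0 <= H <= T there, so row_sum_le gives diagonal dominance. *)
Lemma quad_dominant_combination s u : `|s| <= 2 ->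
  0 <= quad (H - T + s *: H) u.
Proof.
rewrite ler_norml => /andP[s_lo s_hi]; apply: dominant_quad_ge0.
  by rewrite !linearD !linearZ linearN /= toeplitz_sym hankel_sym.
(* The diagonal entry is at least this value because s >= -2; the subtracted [H i i] is the diagonal
   term of the Hankel sum in [row_sum_le]. *)
move=> i; apply: (@le_trans _ _ (- t 0 - H i i)); last first.
  have := hankel_ge0 i i; rewrite !mxE distnn; nra.
rewrite lerBrDr (le_trans _ (row_sum_le i)) // [X in _ <= _ + X](bigD1 i) //=.
rewrite addrCA [leRHS]addrC lerD2r -big_split /=.
apply: ler_sum => j ji.
have -> : (H - T + s *: H) i j = H i j - T i j + s * H i j by rewrite !mxE.
have := hankel_ge0 i j; have := hankel_le_toeplitz ji.
move: (T i j) (H i j) => x y yx y0.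
have s_hi_y : s * y <= 2 * y by rewrite ler_wpM2r.
have s_lo_y : - 2 * y <= s * y by rewrite ler_wpM2r.
by rewrite ler_norml; apply/andP; split; lra.
Qed.

(** The extreme cases s = 2 and s = -2 give the two signs, as [H - T] is minus [tau T]. *)
Lemma quad_hankel_le u : `|quad H u| <= - quad (tau T) u / 2.
Proof.
have := @quad_dominant_combination 2 u.
have := @quad_dominant_combination (- 2) u.
rewrite normrN normr_nat lexx tau_toeplitz !(quadD, quadN, quadZ).
move=> /(_ isT) lo /(_ isT) hi.
by rewrite ler_norml -/H; apply/andP; split; lra.
Qed.

End TauBound.

(** * The one-dimensional fractional matrices *)

Lemma c_dir_ge0 (R : realType) (alpha dt k h : R) :
  1 < alpha < 2 -> 0 < dt -> 0 < k -> 0 <= c_dir alpha dt k h.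
Proof.
move=> alpha12 dt0 k0; rewrite divr_ge0 ?powR_ge0 //.
by rewrite mulr_ge0 ?c_frac_ge0 // ltW // mulr_gt0.
Qed.

Section FractionalMatrix.
Variables (R : realType) (alpha c : R) (n : nat).
Hypotheses (alpha12 : 1 < alpha < 2) (c0 : 0 <= c).

Let A := c *: G_mx n alpha.

Lemma scaled_G_mxE : A = toeplitz n (fun k => c * G_val alpha k).
Proof. by apply/matrixP => i j; rewrite !mxE. Qed.

Lemma scaled_G_mx_sym : A^T = A.
Proof. by rewrite scaled_G_mxE toeplitz_sym. Qed.

Lemma tau_scaled_G_mx_sym : (tau A)^T = tau A.
Proof.
by rewrite scaled_G_mxE tau_toeplitz linearB /= toeplitz_sym hankel_sym.
Qed.

(** The error is the Hankel correction, and scaling by c >= 0 preserves sign, monotonicity and the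
    sum bound of the coefficients. *)
Lemma quad_tau_error_le u : `|quad A u - quad (tau A) u| <= - quad (tau A) u / 2.
Proof.
pose t k := c * G_val alpha k.
have t_ge0 k : (0 < k)%N -> 0 <= t k by move=> ?; rewrite mulr_ge0 ?G_val_ge0.
have t_decr k : (0 < k)%N -> t k.+1 <= t k.
  by move=> ?; rewrite ler_wpM2l ?G_val_decr.
have t_sum : \sum_(1 <= k < n) t k <= - t 0 / 2.
  by rewrite -mulr_sumr /t -mulrN -mulrA ler_wpM2l ?G_val_sum.
rewrite scaled_G_mxE [X in `|_ - quad X _|]tau_toeplitz quadD quadN.
by rewrite opprB addrCA subrr addr0 quad_hankel_le.
Qed.

End FractionalMatrix.

(** * Passage to two dimensions and the spectral bound *)

Lemma kron_sum_sym (R : realType) n1 n2 (X : 'M[R]_n1) (Y : 'M[R]_n2) :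
  X^T = X -> Y^T = Y -> (kron_sum X Y)^T = kron_sum X Y.
Proof.
by move=> symX symY; rewrite linearD /= !trmx_tens !trmx1 symX symY.
Qed.

(** Both sides split over grid lines, so the one-dimensional bounds add up by the triangle
    inequality. *)
Lemma kron_sum_error_le (R : realType) n1 n2
    (X X' : 'M[R]_n1) (Y Y' : 'M[R]_n2) u :
  (forall v, `|quad X v - quad X' v| <= - quad X' v / 2) ->
  (forall v, `|quad Y v - quad Y' v| <= - quad Y' v / 2) ->
  `|quad (kron_sum X Y) u - quad (kron_sum X' Y') u| <=
    - quad (kron_sum X' Y') u / 2.
Proof.
move=> errX errY; rewrite !quad_kron_sum opprD addrACA -!sumrB.
rewrite mulrDl -!sumrN !mulr_suml.
apply: le_trans (ler_normD _ _) _.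
by apply: lerD; apply: le_trans (ler_norm_sum _ _ _) _; apply: ler_sum.
Qed.

(* The order on R[i] is partial: u <= v means Re u <= Re v and Im u = Im v,
   so the conclusion includes that lambda is real. *)
Theorem lemma4p5 (R : realType)
  (a b c d : R) (Hab : a < b) (Hcd : c < d)
  (Omega : set (R^o * R^o))
  (Omega_convex : convex_set Omega)
  (Omega_sub : Omega `<=` [set p | a < p.1 < b /\ c < p.2 < d])
  (alpha1 alpha2 : R) (Halpha1 : 1 < alpha1 < 2) (Halpha2 : 1 < alpha2 < 2)
  (kx ky eta dt : R)
  (Hkx : 0 < kx) (Hky : 0 < ky) (Heta : 0 < eta) (Hdt : 0 < dt)
  (n1 n2 : nat) (Hn1 : (0 < n1)%N) (Hn2 : (0 < n2)%N) :
  let Ax := c_dir alpha1 dt kx (step a b n1) *: G_mx n1 alpha1 in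
  let Ay := c_dir alpha2 dt ky (step c d n2) *: G_mx n2 alpha2 in
  let D := penalty_mx n1 n2 Omega a b c d dt eta in
  let M := 1%:M - kron_sum Ax Ay + D in
  let P := 1%:M - kron_sum (tau Ax) (tau Ay) + D in
  forall lambda : R[i],
    eigenvalue (map_mx (real_complex R) (invmx P *m M)) lambda ->
    1 / 2 <= lambda <= 3 / 2.
Proof.
move=> Ax Ay D M P lambda.
have dt_eta : 0 <= dt / eta by rewrite divr_ge0 // ltW.
have cx0 := c_dir_ge0 (step a b n1) Halpha1 Hdt Hkx.
have cy0 := c_dir_ge0 (step c d n2) Halpha2 Hdt Hky.
have symD : D^T = D by rewrite tr_diag_mx.
have D0 u : 0 <= quad D u.
  apply: quad_diag_ge0 => k; rewrite mxE.
  by case: (mxtens_unindex k) => j i /=; case: ifP.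
have err u := kron_sum_error_le u
  (@quad_tau_error_le _ _ _ n1 Halpha1 cx0)
  (@quad_tau_error_le _ _ _ n2 Halpha2 cy0).
have quadP u : quad P u =
    quad 1%:M u - quad (kron_sum (tau Ax) (tau Ay)) u + quad D u.
  by rewrite 2!quadD quadN.
have quadM u : quad M u = quad 1%:M u - quad (kron_sum Ax Ay) u + quad D u.
  by rewrite 2!quadD quadN.
have id0 u : 0 <= quad (1%:M : 'M[R]_(n2 * n1)) u.
  by rewrite -diag_const_mx quad_diag_ge0 // => i; rewrite mxE.
(* The right side of [err] dominates an absolute value, hence is nonnegative. *)
have tau0 u : 0 <= - quad (kron_sum (tau Ax) (tau Ay)) u.
  by have := le_trans (normr_ge0 _) (err u); rewrite -/Ax -/Ay; lra.
have -> : 1 / 2 = (1 / 2 : R)%:C by rewrite fmorph_div rmorph1 rmorph_nat.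
have -> : 3 / 2 = (3 / 2 : R)%:C by rewrite fmorph_div !rmorph_nat.
apply: pencil_eigenvalue_bounds.
- rewrite linearD linearB /= trmx1 symD kron_sum_sym //;
    exact: tau_scaled_G_mx_sym.
- rewrite linearD linearB /= trmx1 symD kron_sum_sym //; exact: scaled_G_mx_sym.
- move=> u /quad_scalar_gt0 u0; rewrite quadP.
  by have := tau0 u; have := D0 u; lra.
(* The forms of [M] and [P] differ by at most half the tau term, which is at most half of [quad P u]
   since the identity and [D] contribute nonnegatively. *)
- move=> u; rewrite quadP quadM.
  have := err u; rewrite -/Ax -/Ay ler_norml => /andP[].
  have := id0 u; have := D0 u; move=> *; apply/andP; split; lra.
Qed.
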